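(* In $\mathbb{Q}[t][[x]]$ one has the identity $$B(e^{tx})=\frac{1}{1-(e^x-1)t},$$ where $e^{tx}=\sum_{k\ge 0}\frac{t^k}{k!}x^k$ and the right-hand side denotes the formal power series $\sum_{j\ge0}(e^x-1)^jt^j$.
   Context: For a polynomial $g(t)$ and $k\ge0$, $\Delta^k\{g(l)\}_l$ denotes the first term (at $l=0$) of the $k$-th iterated finite difference of the sequence $\{g(l)\}_{l\ge 0}$, i.e. $\Delta^k\{g(l)\}_l=\sum_{m=0}^k(-1)^{k-m}\binom{k}{m}g(m)$. The linear map $b$ on polynomials in $t$ (the map induced by barycentric subdivision) is $$b(g(t))=\sum_{k\ge0}\Delta^k\{g(l)\}_l\,t^k,$$ a finite sum for each polynomial $g$. The map $B$ on formal power series in $x$ with coefficients polynomials in $t$ is defined by $B\big(\sum_{k\ge0}g_k(t)x^k\big)=\sum_{k\ge0}b(g_k(t))x^k$. *)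

(* Defs.v *)
From HB Require Import structures.
From mathcomp Require Import all_boot all_order all_algebra.
From mathcomp Require Import boolp.

Set Implicit Arguments.
Unset Strict Implicit.
Unset Printing Implicit Defensive.

Import GRing.Theory.
Local Open Scope ring_scope.

(* R[[x]]; [f n] is the coefficient of x^n. *)
Record fps (R : comNzRingType) := FPS { fps_coef :> nat -> R }.

Section FormalPowerSeries.
Variable R : comNzRingType.
Implicit Types f g h S : fps R.

Lemma fpsP f g : (forall n, f n = g n) -> f = g.
Proof. by case: f g => [f] [g] /= fg; congr FPS; apply/funext. Qed.

HB.instance Definition _ := gen_eqMixin (fps R).
HB.instance Definition _ := gen_choiceMixin (fps R).

Definition fpsC (c : R) : fps R := FPS (fun n => if n == 0%N then c else 0).
Definition fps_opp f : fps R := FPS (fun n => - f n).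
Definition fps_add f g : fps R := FPS (fun n => f n + g n).
Definition fps_mul f g : fps R :=
  FPS (fun n => \sum_(i < n.+1) f i * g (n - i)%N).

Let fps_addA : associative fps_add.
Proof. by move=> f g h; apply: fpsP => n /=; rewrite addrA. Qed.
Let fps_addC : commutative fps_add.
Proof. by move=> f g; apply: fpsP => n /=; rewrite addrC. Qed.
Let fps_add0 : left_id (fpsC 0) fps_add.
Proof. by move=> f; apply: fpsP => n /=; rewrite if_same add0r. Qed.
Let fps_addN : left_inverse (fpsC 0) fps_opp fps_add.
Proof. by move=> f; apply: fpsP => n /=; rewrite if_same addNr. Qed.

HB.instance Definition _ :=
  GRing.isZmodule.Build (fps R) fps_addA fps_addC fps_add0 fps_addN.

(* Ring laws are inherited from {poly R} by truncation. *)
Let trunc N f : {poly R} := \poly_(i < N) f i.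

Let fps_mul_trunc N f g n : (n < N)%N ->
  fps_mul f g n = (trunc N f * trunc N g)`_n.
Proof.
move=> ltnN; rewrite coefM; apply: eq_bigr => i _.
rewrite !coef_poly !ifT //; first exact: leq_ltn_trans (leq_subr _ _) ltnN.
exact: leq_trans (ltn_ord i) ltnN.
Qed.

Let fps_mulC : commutative fps_mul.
Proof.
by move=> f g; apply: fpsP => n; rewrite !(@fps_mul_trunc n.+1) // mulrC.
Qed.

Let coefM_low (p q p' q' : {poly R}) n :
    (forall i, (i <= n)%N -> p`_i = p'`_i) ->
    (forall i, (i <= n)%N -> q`_i = q'`_i) ->
  (p * q)`_n = (p' * q')`_n.
Proof.
move=> eqp eqq; rewrite !coefM; apply: eq_bigr => i _.
by rewrite eqp ?eqq ?leq_subr // -ltnS.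
Qed.

Let fps_mulA : associative fps_mul.
Proof.
move=> f g h; apply: fpsP => n; rewrite !(@fps_mul_trunc n.+1) //.
have E f1 f2 i : (i <= n)%N ->
    (trunc n.+1 (fps_mul f1 f2))`_i = (trunc n.+1 f1 * trunc n.+1 f2)`_i.
  by move=> lein; rewrite coef_poly ltnS lein (@fps_mul_trunc n.+1).
rewrite (@coefM_low _ _ (trunc n.+1 f) (trunc n.+1 g * trunc n.+1 h)) //; last exact: E.
rewrite mulrA; apply: coefM_low => // i lein; by rewrite E.
Qed.

Let fps_mul1 : left_id (fpsC 1) fps_mul.
Proof.
move=> f; apply: fpsP => n /=; rewrite big_ord_recl /= mul1r subn0.
by rewrite big1 ?addr0 // => i _; rewrite mul0r.
Qed.
Let fps_mulDl : left_distributive fps_mul fps_add.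
Proof.
move=> f g h; apply: fpsP => n /=; rewrite -big_split /=.
by apply: eq_bigr => i _; rewrite mulrDl.
Qed.
Let fps_1_neq0 : fpsC 1 != 0.
Proof. by apply/eqP => /(congr1 (@fps_coef R ^~ 0%N)) /= /eqP; rewrite oner_eq0. Qed.

HB.instance Definition _ :=
  GRing.Zmodule_isComNzRing.Build (fps R)
    fps_mulA fps_mulC fps_mul1 fps_mulDl fps_1_neq0.

(* [\sum_(j >= 0) F j = S] for the x-adic topology, R being discrete. *)
Definition fps_has_sum (F : nat -> fps R) S : Prop :=
  forall n, exists N, forall M, (N <= M)%N -> (\sum_(j < M) F j) n = S n.

Lemma fps_has_sum_unique F S1 S2 :
  fps_has_sum F S1 -> fps_has_sum F S2 -> S1 = S2.
Proof.
move=> s1 s2; apply: fpsP => n; have [N1 e1] := s1 n; have [N2 e2] := s2 n.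
by rewrite -(e1 (maxn N1 N2)) ?leq_maxl // e2 // leq_maxr.
Qed.

Lemma fps_has_sum_geometric u S :
  fps_has_sum (fun j => u ^+ j) S -> (1 - u) * S = 1.
Proof.
move=> sS; apply: fpsP => n.
have [M eM] : exists M, forall m M', (m <= n)%N -> (M <= M')%N ->
    (\sum_(j < M') u ^+ j) m = S m.
  elim: n => [|n [M1 e1]].
    by have [N eN] := sS 0%N; exists N => m M'; rewrite leqn0 => /eqP->; apply: eN.
  have [N2 e2] := sS n.+1; exists (maxn M1 N2) => m M'.
  rewrite geq_max leq_eqVlt => /orP[/eqP->|ltmn] /andP[le1 le2]; first exact: e2.
  exact: e1.
have uM0 m : (m <= n)%N -> (u ^+ M) m = 0.
  move=> lemn; have := eM m M.+1 lemn (leqnSn M).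
  rewrite big_ord_recr /= -(eM m M lemn (leqnn M)) => /eqP.
  by rewrite -subr_eq0 addrC addKr => /eqP.
transitivity (((1 - u) * \sum_(j < M) u ^+ j) n).
  by apply: eq_bigr => i _; rewrite (eM _ M) ?leq_subr.
rewrite -opprB mulNr -subrX1 opprB.
by change ((1 : fps R) n - (u ^+ M) n = (1 : fps R) n); rewrite uM0 ?subr0.
Qed.

End FormalPowerSeries.

(* e^{a x} in Q[t][[x]], for a in Q[t]; t is the variable 'X of {poly rat}. *)
Definition fps_exp (a : {poly rat}) : fps {poly rat} :=
  FPS (fun k => (k`!%:R : rat)^-1 *: a ^+ k).

Definition fdiff (u : nat -> rat) : nat -> rat := fun l => u l.+1 - u l.

Definition Delta (k : nat) (u : nat -> rat) : rat := iter k fdiff u 0%N.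

Lemma DeltaE k u :
  Delta k u = \sum_(m < k.+1) (-1) ^+ (k - m) * 'C(k, m)%:R * u m.
Proof.
rewrite /Delta -[u in RHS]/(fun m => u (0 + m)%N); move: 0%N.
elim: k => [|k IH] n.
  by rewrite big_ord1 /= subnn bin0 expr0 !mul1r addn0.
rewrite iterS /fdiff !IH.
rewrite [RHS]big_ord_recl /= subn0 bin0 mulr1 addn0.
rewrite [X in _ - X]big_ord_recl /= subn0 bin0 mulr1 addn0 opprD addrCA.
rewrite exprS mulN1r mulNr; congr (_ + _).
under [in RHS]eq_bigr => i _ do
  rewrite /bump /= add1n subSS binS natrD mulrDr mulrDl addnS -addSn.
rewrite big_split /= [LHS]addrC; congr (_ + _).
rewrite [in RHS]big_ord_recr /= bin_small // mulr0 mul0r addr0 -sumrN.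
apply: eq_bigr => i _; rewrite /bump /= add1n.
rewrite addSn -addnS -!mulNr; congr (_ * _ * _).
by rewrite -[in RHS](@subnSK i k) // exprS mulN1r.
Qed.

Lemma Delta_eq0 k (g : {poly rat}) :
  (size g <= k)%N -> Delta k (fun l => g.[l%:R]) = 0.
Proof.
rewrite /Delta; move: 0%N; elim: k g => [|k IH] g n sg.
  by move: sg; rewrite leqn0 size_poly_eq0 => /eqP->; rewrite /= horner0.
rewrite iterSr.
have -> : fdiff (fun l => g.[l%:R]) =
    (fun l => (g \Po ('X + 1%:P) - g).[l%:R]).
  apply/funext => l; rewrite /fdiff !hornerE horner_comp !hornerE.
  by rewrite -natr1.
apply: IH; have [->|g0] := eqVneq g 0; first by rewrite comp_poly0 subr0 size_poly0.
have s2 : size ('X + 1%:P : {poly rat}) = 2%N by rewrite size_XaddC.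
have sc : size (g \Po ('X + 1%:P)) = size g by rewrite size_comp_poly2.
have lc : (g \Po ('X + 1%:P))`_(size g).-1 = g`_(size g).-1.
  rewrite -[in LHS]sc -!lead_coefE lead_coef_comp ?s2 //.
  by rewrite lead_coefDl ?size_polyX ?size_polyC // lead_coefX expr1n mulr1.
apply/leq_sizeP => j lekj; rewrite coefB.
have := leq_trans sg (lekj : (k.+1 <= j.+1)%N).
rewrite leq_eqVlt => /orP[/eqP sj|ltj].
  by move: lc; rewrite sj /= => ->; rewrite subrr.
by rewrite !nth_default ?subrr ?sc.
Qed.

(* Truncating at [size g] is harmless by [Delta_eq0]. *)
Definition b (g : {poly rat}) : {poly rat} :=
  \sum_(k < size g) Delta k (fun l => g.[l%:R]) *: 'X^k.

Lemma bE N (g : {poly rat}) : (size g <= N)%N ->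
  b g = \sum_(k < N) Delta k (fun l => g.[l%:R]) *: 'X^k.
Proof.
move=> sgN; rewrite /b (big_ord_widen N (fun k => Delta k (fun l => g.[l%:R]) *: 'X^k) sgN).
rewrite [RHS](bigID (fun k : 'I_N => (k < size g)%N)) /=.
rewrite [X in _ + X]big1 ?addr0 // => k; rewrite -leqNgt => /Delta_eq0->.
by rewrite scale0r.
Qed.

Definition B (f : fps {poly rat}) : fps {poly rat} := FPS (fun k => b (f k)).

(* Main.v *)
Require Import Defs.
From mathcomp Require Import all_boot all_order all_algebra.
From mathcomp Require Import boolp.
Import GRing.Theory Num.Theory.
Local Open Scope ring_scope.

(** Write E for e^x. Multiplying powers of E by E - 1 is the same as taking
    finite differences in the exponent, since E^l (E - 1) = E^(l+1) - E^l.
    Iterating j times from the sequence (E^l)_l and reading off the coefficient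
    of x^n, which for E^l = e^(l x) is l^n / n!, shows that the coefficient of
    x^n in (E - 1)^j is the j-th difference at 0 of l |-> l^n / n!
    ([coef_exp_sub1X]). By definition of b, this is also the coefficient of
    t^j in b(t^n / n!), hence that of t^j x^n in B(e^(t x)).

    The sum over j converges because these differences vanish for j > n, as
    t^n / n! has degree n ([bE]): the coefficient of x^n in the partial sums is
    stationary from M = n + 1 on. *)

Lemma fps_coef_sum (R : comNzRingType) I (r : seq I) (P : pred I) (F : I -> fps R) n :
  (\sum_(j <- r | P j) F j) n = \sum_(j <- r | P j) F j n.
Proof.
apply: (big_morph (fun f : fps R => f n)) => //.
exact: if_same.
Qed.

Lemma fps_coefMCX (R : comNzRingType) (f : fps R) c j n :
  (f * fpsC c ^+ j) n = f n * c ^+ j.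
Proof.
have coefMC (g : fps R) : (g * fpsC c) n = g n * c.
  rewrite [LHS]big_ord_recr /= subnn big1 ?add0r // => i _.
  by rewrite subn_eq0 leqNgt ltn_ord mulr0.
elim: j => [|j IHj] in f *; first by rewrite !mulr1.
by rewrite exprSr mulrA coefMC IHj exprSr mulrA.
Qed.

(** The binomial theorem, once n! / (i! (n - i)!) is recognised as a binomial
    coefficient. *)
Lemma fps_expD (a c : {poly rat}) : fps_exp (a + c) = fps_exp a * fps_exp c.
Proof.
apply: fpsP => n; rewrite /= addrC exprDn scaler_sumr.
apply: eq_bigr => i _; have le_in : (i <= n)%N by rewrite -ltnS.
rewrite -scalerAl -scalerAr scalerA -scaler_nat scalerA mulrC.
rewrite [c ^+ _ * _]mulrC; congr (_ *: _).
rewrite -(bin_fact le_in) !natrM !invfM mulVKf //.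
by rewrite pnatr_eq0 -lt0n bin_gt0.
Qed.

Lemma fps_exp0 : fps_exp 0 = 1.
Proof.
apply: fpsP => -[|n] /=; first by rewrite fact0 invr1 scale1r.
by rewrite expr0n scaler0.
Qed.

Lemma fps_exp_nat l : fps_exp l%:R = fps_exp 1 ^+ l.
Proof.
elim: l => [|l IHl]; first exact: fps_exp0.
by rewrite -natr1 fps_expD IHl exprSr.
Qed.

(** The factor e^(l x) keeps track of the base point l of the difference, which
    the induction on j shifts. *)
Lemma coef_exp_sub1X j l n :
  ((fps_exp 1 - 1) ^+ j * fps_exp 1 ^+ l) n =
  (iter j fdiff (fun m => (n`!%:R)^-1 * m%:R ^+ n) l)%:P.
Proof.
elim: j l => [|j IHj] l.
  by rewrite expr0 mul1r -fps_exp_nat /= -mul_polyC polyCM polyC_exp polyC_natr.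
rewrite exprSr -mulrA mulrBl mul1r -exprS mulrBr.
by rewrite iterS /fdiff polyCB -!IHj.
Qed.

Theorem theorem3 :
  fps_has_sum (fun j : nat => (fps_exp 1 - 1) ^+ j * fpsC 'X ^+ j)
              (B (fps_exp 'X)).
Proof.
move=> n; exists n.+1 => M lt_nM.
have szM : (size ((n`!%:R : rat)^-1 *: 'X^n) <= M)%N.
  by apply: leq_trans (size_scale_leq _ _) _; rewrite size_polyXn.
rewrite fps_coef_sum [RHS]/= (bE szM); apply: eq_bigr => j _.
have := coef_exp_sub1X j 0 n; rewrite expr0 mulr1 => coef_jn.
rewrite fps_coefMCX coef_jn mul_polyC /Delta.
have -> : (fun l => ((n`!%:R : rat)^-1 *: 'X^n).[l%:R]) =
          (fun l => (n`!%:R)^-1 * l%:R ^+ n).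
  by apply/funext => l; rewrite hornerZ hornerXn.
by [].
Qed.
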